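(* For any end-vertex $u\in\mathcal{E}$ of $\mathcal{T}$ one has the recursion of quasipolynomials $$\mathcal{L}^{\mathcal{T}}_{[x]}(x)=\mathcal{L}^{\mathcal{T}\setminus u}_{[\pi^{(u)}(x)]}(\pi^{(u)}(x))+\mathcal{L}^{u}_{[x]}(x_u)$$ for all $x=\sum_{v\in\mathcal{V}}x_vE_v\in L'$.
   Context: $\mathcal{T}$ is a finite tree (a connected negative definite plumbing graph with all genera zero) with vertex set $\mathcal{V}$; $\delta_v$ is the valency of $v$ and $\mathcal{E}=\{v:\delta_v=1\}$ is the set of end-vertices. $L=\mathbb{Z}\langle E_v\rangle_{v\in\mathcal{V}}$ is a free lattice with a negative definite integral symmetric form $(\,,\,)$ such that, for $v\ne w$, $(E_v,E_w)=1$ if $\overline{vw}$ is an edge and $0$ otherwise. $L'\subset L\otimes\mathbb{Q}$ is the dual lattice, freely generated by the $E_v^*$ with $(E_v^*,E_w)=-1$ if $v=w$ and $0$ otherwise (all coordinates of $E_v^*$ in the basis $\{E_w\}$ are positive). $H=L'/L$ is finite; $[x]$ is the class of $x$. $\mathcal{S}'=\mathbb{Z}_{\ge0}\langle E_v^*\rangle_v$ and $\operatorname{int}(\mathcal{S}')=\mathbb{Z}_{>0}\langle E_v^*\rangle_v$. For $y=\sum y_vE_v$ put $\mathbf{t}^y=\prod_v t_v^{y_v}$. Let $\sum_{l'}p_{l'}\mathbf{t}^{l'}$ be the Taylor expansion at the origin of $\prod_v(1-\mathbf{t}^{E_v^*})^{\delta_v-2}$; for $h\in H$, $Q_h(x)=\sum_{l'\not\ge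 x,[l']=h}p_{l'}$ (coordinatewise order; finite sum). $\mathcal{L}_h=\mathcal{L}_h^{\mathcal{T}}$ is the unique quasipolynomial on $L'$ with $\mathcal{L}_h(x)=Q_h(x)$ for all $x\in\sum_v(\delta_v-2)E_v^*+\operatorname{int}(\mathcal{S}')$. (A quasipolynomial on a lattice is a function that is polynomial on each coset of some finite-index sublattice.) $\mathcal{T}\setminus u$ is the tree obtained by deleting the vertex $u$ and its edge, with the restricted intersection form on $L_{\mathcal{T}\setminus u}=\mathbb{Z}\langle E_v\rangle_{v\ne u}$; $L'_{\mathcal{T}\setminus u}$ is its dual lattice with generators again denoted $E_v^*$ ($v\ne u$), and $\mathcal{L}^{\mathcal{T}\setminus u}_{g}$, $g\in L'_{\mathcal{T}\setminus u}/L_{\mathcal{T}\setminus u}$, are the quasipolynomials defined in the same way for $\mathcal{T}\setminus u$ (with its own valencies). $\pi^{(u)}:L'\to L'_{\mathcal{T}\setminus u}$ is the linear map with $\pi^{(u)}(E_v^* )=E_v^*$ for $v\ne u$ and $\pi^{(u)}(E_u^* )=0$. Let $f_H(t_u)=\prod_{v\in\mathcal{V}}(1-[E_v^*]\,t_u^{(E_v^* )_u})^{\delta_v-2}$, where $(E_v^* )_u$ is the $E_u$-coefficient of $E_v^*$ (coefficients in $\mathbb{Z}[H]$). $\mathcal{L}^u_H=\sum_{h\in H}\mathcal{L}^u_h\cdot h$ is the $\mathbb{Z}[H]$-valued quasipolynomial (on the lattice $\{y_u:y\in L'\}\subset\mathbb{Q}$) such that $\mathcal{L}^u_H(w)$ equals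 the coefficient of $t_u^w$ in the Taylor expansion at the origin of $f_H(t_u)\frac{t_u}{1-t_u}$ for $w\gg0$. *)

(* Defs.v *)
(* MathComp, with the classical sets and finitely supported sums of
   MathComp-Analysis. *)
From HB Require Import structures.
From mathcomp Require Import all_boot all_order all_algebra.
From mathcomp Require Import ring_quotient generic_quotient.
From mathcomp Require Import boolp classical_sets fsbigop.
From mathcomp Require mpoly.

Set Implicit Arguments.
Unset Strict Implicit.
Unset Printing Implicit Defensive.

Import Order.TTheory GRing.Theory Num.Theory.
Local Open Scope ring_scope.
Local Open Scope quotient_scope.
Local Open Scope classical_set_scope.

(* The vertex set is 'I_n; [euler T v] is the self-intersection (E_v, E_v). *)
Record plumbing (n : nat) := Plumbing {
  edge : rel 'I_n;
  euler : 'I_n -> int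
}.

(* L (x) Q is 'rV[rat]_n, a row vector listing the coordinates in the basis
   (E_v)_v; L is the subgroup of integral vectors. *)
Definition lattice (n : nat) : {pred 'rV[rat]_n} :=
  fun x => x \is a mxOver Num.int.
Arguments lattice n _ : clear implicits.

Fact lattice_zmod_closed n : zmod_closed (lattice n).
Proof.
split=> [|x y Lx Ly]; apply/mxOverP => i j; first by rewrite mxE rpred0.
by rewrite !mxE rpredB //; [move/mxOverP: Lx|move/mxOverP: Ly]; apply.
Qed.

HB.instance Definition _ n :=
  GRing.isZmodClosed.Build 'rV[rat]_n (lattice n) (@lattice_zmod_closed n).

(* H = L'/L is the subgroup of (L (x) Q)/L formed by the classes [y] of the
   elements y of L'; "h in H" is rendered by h = [y] with y in L'. *)
Definition disc (n : nat) := {ideal_quot (lattice n)}.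

Definition cls (n : nat) (x : 'rV[rat]_n) : disc n := \pi_(disc n) x.

Definition lev (n : nat) (x y : 'rV[rat]_n) : Prop :=
  forall v, x 0 v <= y 0 v.

Section Plumbing.
Variables (n : nat) (T : plumbing n).

Definition valency (v : 'I_n) : nat := #|[pred w | edge T v w]|.

Definition end_vertex (v : 'I_n) : Prop := valency v = 1%N.

Definition intersection_mx : 'M[rat]_n :=
  \matrix_(v, w) (if v == w then euler T v else (edge T v w)%:Z)%:~R.

Definition form (x y : 'rV[rat]_n) : rat :=
  (x *m intersection_mx *m y^T) 0 0.

Definition is_tree : Prop :=
  [/\ symmetric (edge T), irreflexive (edge T),
      forall v w, connect (edge T) v w
    & forall c, ucycle (edge T) c -> (size c <= 2)%N].

Definition negative_definite : Prop :=
  forall l, l \in lattice n -> l != 0 -> form l l < 0.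

Definition dual_lattice : set 'rV[rat]_n :=
  [set x | forall l, l \in lattice n -> form x l \is a Num.int].

(* The row v of -I^-1, I being the intersection matrix, so that
   (E_v^*, E_w) = - (v == w): see [form_Estar]. *)
Definition Estar (v : 'I_n) : 'rV[rat]_n := row v (- invmx intersection_mx).

Definition interior_cone : set 'rV[rat]_n :=
  [set x | exists2 a : 'I_n -> int,
     (forall v, 0 < a v) & x = \sum_v (a v)%:~R *: Estar v].

Definition dm2 (v : 'I_n) : int := (valency v)%:Z - 2.

End Plumbing.

(* Taylor coefficient of s^k in (1 - s)^m, m an integer: for m < 0 it is read
   off the |m|-th power of the geometric series truncated after s^k. *)
Definition one_sub_pow_coef (m : int) (k : nat) : int :=
  match m with
  | Posz d => ((1 - 'X : {poly int}) ^+ d)`_k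
  | Negz d => ((\sum_(j < k.+1) 'X^j : {poly int}) ^+ d.+1)`_k
  end.

(* Coefficient of t^y in the product over v of the Taylor expansions of
   (1 - t^(g v))^(m v), exponents being taken in an additive group M.  The sum
   is over a possibly infinite set of multi-indices a: [\sum_(a \in _)] is the
   finitely supported sum, and in every use below the support is finite. *)
Definition taylor_coef (n : nat) (M : zmodType) (g : 'I_n -> M)
    (m : 'I_n -> int) (y : M) : int :=
  \sum_(a \in [set a : {ffun 'I_n -> nat} | \sum_v g v *+ a v = y])
    \prod_v one_sub_pow_coef (m v) (a v).

Definition zeta_coef (n : nat) (T : plumbing n) (l : 'rV[rat]_n) : int :=
  taylor_coef (Estar T) (dm2 T) l.

Definition counting (n : nat) (T : plumbing n) (h : disc n)
    (x : 'rV[rat]_n) : int :=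
  \sum_(l \in [set l | [/\ dual_lattice T l, ~ lev x l & cls l = h]])
    zeta_coef T l.

Definition finite_index_sublattice (m : nat) (M Lam : set 'rV[rat]_m) : Prop :=
  [/\ M 0, (forall x y, M x -> M y -> M (x - y)), M `<=` Lam
    & exists s : seq 'rV[rat]_m,
        forall x, Lam x -> exists2 r, r \in s & M (x - r)].

(* The values of f outside of Lam are irrelevant. *)
Definition quasipolynomial (m : nat) (Lam : set 'rV[rat]_m)
    (f : 'rV[rat]_m -> rat) : Prop :=
  exists2 M, finite_index_sublattice M Lam &
    forall r, Lam r -> exists P : mpoly.mpoly m rat,
      forall x, M (x - r) -> f x = mpoly.meval (fun v => x 0 v) P.

(* [F h] is the quasipolynomial L_h, for every h in H. *)
Definition is_counting_quasipolynomial (n : nat) (T : plumbing n)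
    (F : disc n -> 'rV[rat]_n -> rat) : Prop :=
  forall y, dual_lattice T y ->
    quasipolynomial (dual_lattice T) (F (cls y)) /\
    forall c, interior_cone T c ->
      let x := \sum_v (dm2 T v)%:~R *: Estar T v + c in
      F (cls y) x = (counting T (cls y) x)%:~R.

(* Coefficient of h t_u^w in f_H(t_u): the exponents lie in the product of
   (L (x) Q)/L, which accounts for Z[H], and of Q. *)
Definition fH_coef (n : nat) (T : plumbing n) (u : 'I_n) (h : disc n)
    (w : rat) : int :=
  taylor_coef (fun v => (cls (Estar T v), Estar T v 0 u) : disc n * rat)
    (dm2 T) (h, w).

(* Coefficient of h t_u^w in f_H(t_u) t_u / (1 - t_u), where
   t_u / (1 - t_u) is the sum of the t_u^k for k >= 1. *)
Definition fH_geom_coef (n : nat) (T : plumbing n) (u : 'I_n) (h : disc n)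
    (w : rat) : int :=
  \sum_(k \in [set k : nat | (0 < k)%N]) fH_coef T u h (w - k%:R).

Definition coord_lattice (n : nat) (T : plumbing n) (u : 'I_n) : set rat :=
  [set w | exists2 y, dual_lattice T y & y 0 u = w].

(* [F h] is the h-component of the Z[H]-valued quasipolynomial attached to u.
   The lattice of u-coordinates is viewed inside 'rV[rat]_1. *)
Definition is_vertex_quasipolynomial (n : nat) (T : plumbing n) (u : 'I_n)
    (F : disc n -> rat -> rat) : Prop :=
  (forall y, dual_lattice T y ->
     quasipolynomial [set z : 'rV[rat]_1 | coord_lattice T u (z 0 0)]
       (fun z => F (cls y) (z 0 0))) /\
  exists N : rat, forall w, coord_lattice T u w -> N <= w ->
    forall y, dual_lattice T y ->
      F (cls y) w = (fH_geom_coef T u (cls y) w)%:~R.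

(* The vertices of T \ u are numbered by [lift u : 'I_n -> 'I_n.+1]. *)
Definition delete (n : nat) (T : plumbing n.+1) (u : 'I_n.+1) : plumbing n :=
  Plumbing (fun v w => edge T (lift u v) (lift u w))
           (fun v => euler T (lift u v)).

(* - (x, E_v) is the coefficient of x on E_v^*: see [proj_Estar]. *)
Definition proj (n : nat) (T : plumbing n.+1) (u : 'I_n.+1)
    (x : 'rV[rat]_n.+1) : 'rV[rat]_n :=
  \sum_v (- form T x (delta_mx 0 (lift u v))) *: Estar (delete T u) v.

Lemma negative_definite_unitmx n (T : plumbing n) :
  negative_definite T -> intersection_mx T \in unitmx.
Proof.
move=> negT; rewrite -row_free_unit -kermx_eq0; apply/rowV0P => x /sub_kermxP xI.
apply/eqP/negP => /negP x0.
pose d : rat := (\prod_j denq (x 0 j))%:~R.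
have d0 : d != 0.
  by rewrite intr_eq0; apply/prodf_neq0 => j _; exact: denq_neq0.
have Ldx : d *: x \in lattice n.
  apply/mxOverP => i j; rewrite (ord1 i) mxE /d (bigD1 j) //= rmorphM /=.
  rewrite mulrAC -{2}[x 0 j]divq_num_den mulrCA divff ?intr_eq0 ?denq_neq0 //.
  by rewrite mulr1 -rmorphM /= intr_int.
have := negT _ Ldx; rewrite /form -scalemxAl xI scaler0 mul0mx mxE ltxx.
by rewrite scaler_eq0 (negPf d0) (negPf x0) => /(_ isT).
Qed.

Lemma form_Estar n (T : plumbing n) (v w : 'I_n) : negative_definite T ->
  form T (Estar T v) (delta_mx 0 w) = - (v == w)%:R.
Proof.
move=> /negative_definite_unitmx uT.
rewrite /form /Estar -row_mul mulNmx mulVmx // trmx_delta -colE !mxE.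
by [].
Qed.

Lemma proj_Estar n (T : plumbing n.+1) (u : 'I_n.+1) : negative_definite T ->
  proj T u (Estar T u) = 0 /\
  forall v, proj T u (Estar T (lift u v)) = Estar (delete T u) v.
Proof.
move=> negT; split=> [|v]; rewrite /proj.
  by rewrite big1 // => w _; rewrite form_Estar // (negPf (neq_lift u w)) opprK scale0r.
rewrite (bigD1 v) //= form_Estar // eqxx opprK scale1r big1 ?addr0 // => w wv.
by rewrite form_Estar // (inj_eq lift_inj) eq_sym (negPf wv) opprK scale0r.
Qed.

(* Main.v *)
Require Import Defs.
From HB Require Import structures.
From mathcomp Require Import all_boot all_order all_algebra.
From mathcomp Require Import ring_quotient.
From mathcomp Require Import boolp classical_sets functions cardinality fsbigop.
From mathcomp Require Import zify ring lra.
From mathcomp Require mpoly.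

(** Let w be the neighbour of the end-vertex u and b = -(E_u, E_u), and write a
    prime for objects of T \ u.

    Along a ray x + t q, with q in a sublattice fine enough for the three
    quasipolynomials, the difference of the two sides is a polynomial in the
    natural number t ([quasipolynomial_ray]).  So it is enough to prove the
    identity for large t along one well chosen ray: the value at t = 0 follows
    ([poly_eventually0]).  The direction q is a positive combination of the
    E*_v in which the coefficient of E*_u dominates the others ([ray_far]).
    For large t the point y = x + t q then lies in the domains where the three
    quasipolynomials are given by coefficients of the series, and moreover
    y_u is large compared with proj y; the latter makes the following
    combinatorial identity [counting_recursion] hold:

      Q_[y](y) = Q'_[proj y](proj y)
                   + (coefficient of [y] t_u^(y_u) in f_H(t_u) t_u / (1 - t_u)).

    The last coefficient is the sum of the p_l with [l] = [y] and l_u < y_u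
    ([fH_geom_sum]), so the first term on the right has to be matched with the
    sum over the gap set: [l] = [y], l_u >= y_u and l not above y.  Since u has
    valency one, the series of T is the series of T \ u in the variables
    t^(E*_v), v <> u, multiplied by (1 - t^(E*_w)) / (1 - t^(E*_u)).
    An Abel summation with respect to the factor 1 - t^(E*_w) ([fsbig_abel])
    turns the sum over the gap set into the sum over multi-indices a on T \ u
    of the coefficient at a times N(a) - N(a + 1_w), where N(a) counts the
    k >= 0 for which k E*_u + sum_v a_v E*_v lies in the gap set.  Two linear
    relations,

      E*_w = b E*_u - E_u                             ([Estar_neighbour]),
      (coordinates of y off u) = proj y + y_u E*'_w   ([drop_coord_proj]),

    show that passing from a to a + 1_w amounts to replacing k by k + b and
    raising the level y_u by one.  As y_u is large, all the k above this level
    are at least b.  Hence N(a) - N(a + 1_w) counts the k for which the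
    u-coordinate is exactly y_u; there is one such k when a contributes to
    Q'_[proj y](proj y), and none otherwise ([fibre_sizeB]).

    All the sums are finite because the E*_v have positive coordinates
    ([Estar_gt0]), by the maximum principle on a connected graph. *)

Set Implicit Arguments.
Unset Strict Implicit.
Unset Printing Implicit Defensive.

Import Order.TTheory GRing.Theory Num.Theory.
Local Open Scope ring_scope.
Local Open Scope classical_set_scope.

(* The name [form] is also used for sesquilinear forms. *)
Local Notation form := Defs.form.

(** * Finitely supported sums and Taylor coefficients *)

Lemma fsbig_fiber (I J : choiceType) (V : nmodType) (g : I -> J) (A : set I)
    (B : set J) (f : I -> V) : finite_set A -> A `<=` g @^-1` B ->
  \sum_(a \in A) f a = \sum_(y \in B) \sum_(a \in A `&` g @^-1` [set y]) f a.
Proof.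
move=> finA AB; have finC : finite_set (g @` A) by apply: finite_image.
rewrite -[RHS](fsbig_widen (g @` A)); first last.
- move=> y [By nCy]; rewrite /preimage /= (_ : _ `&` _ = set0) ?fsbig_set0 //.
  by apply/seteqP; split=> // a [Aa /= ga]; apply: nCy; exists a.
- by move=> _ [a Aa <-]; apply: AB.
transitivity (\sum_(y \in g @` A) \sum_(a \in A) (if g a == y then f a else 0)).
  rewrite exchange_fsbig //; apply: eq_fsbigr => a /set_mem Aa.
  rewrite -[RHS](fsbig_widen [set g a]); first by rewrite fsbig_set1 eqxx.
  - by move=> _ ->; exists a.
  - by move=> y [_ ny] /=; case: eqP => // e; case: ny.
apply: eq_fsbigr => y _; rewrite fsbig_mkcondr.
apply: eq_fsbigr => a _; congr (if _ then _ else _).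
by apply/eqP/idP; rewrite inE.
Qed.

Lemma reindex_fsbig_inj (I J : choiceType) (V : nmodType) (h : I -> J)
    (Q : set J) (F : J -> V) :
  injective h -> Q `<=` range h ->
  \sum_(j \in Q) F j = \sum_(i \in h @^-1` Q) F (h i).
Proof.
move=> hI hQ; apply: reindex_fsbig; split=> //.
- by move=> i j _ _ /hI.
- by move=> j Qj; case: (hQ _ Qj) => i _ e; exists i; rewrite // /preimage /= e.
Qed.

Lemma sum_taylor_coef (n : nat) (M : zmodType) (g : 'I_n -> M) (m : 'I_n -> int)
    (B : set M) :
  finite_set [set a : {ffun 'I_n -> nat} | B (\sum_v g v *+ a v)] ->
  \sum_(y \in B) taylor_coef g m y =
  \sum_(a \in [set a : {ffun 'I_n -> nat} | B (\sum_v g v *+ a v)])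
     \prod_v one_sub_pow_coef (m v) (a v).
Proof.
move=> fin; pose exq (a : {ffun 'I_n -> nat}) := \sum_v g v *+ a v.
rewrite [RHS](@fsbig_fiber _ _ _ exq _ B) //.
apply: eq_fsbigr => y /set_mem By; apply: eq_fsbigl; apply/seteqP.
by split=> [a /= e|a []] //; split=> //=; rewrite e.
Qed.

(** Summation by parts: g is f transported along the injection h, and N has
    finite support. *)
Lemma fsbig_abel (I : choiceType) (V : pzRingType) (h : I -> I) (f g N : I -> V) :
  injective h -> (forall i, g (h i) = f i) ->
  (forall i, ~ range h i -> g i = 0) -> finite_set [set i | N i != 0] ->
  \sum_(i \in setT) (f i - g i) * N i = \sum_(i \in setT) f i * (N i - N (h i)).
Proof.
move=> hI gh g0; set D := mkset _ => finD.
have finhD : finite_set (h @^-1` D).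
  by apply: finite_preimage => // i j _ _; apply: hI.
pose E := D `|` h @^-1` D.
have finE : finite_set E by rewrite finite_setU.
have N0 i : ~ E i -> N i = 0 /\ N (h i) = 0.
  move=> Ei; split; apply/eqP; apply: contra_notT Ei => Ni; [by left|by right].
rewrite -[LHS](fsbig_widen E) //; last by move=> i [_ /N0[/= -> _]]; rewrite mulr0.
rewrite -[RHS](fsbig_widen E) //; last first.
  by move=> i [_ /N0[/= -> ->]]; rewrite subrr mulr0.
under eq_fsbigr do rewrite mulrBl -mulrN.
under [RHS]eq_fsbigr do rewrite mulrBr -mulrN.
rewrite !fsbig_split //; congr (_ + _).
rewrite (fsbig_widen E setT) //; last first.
  by move=> i [_ /N0[/= -> _]]; rewrite oppr0 mulr0.
rewrite [RHS](fsbig_widen E setT) //; last first.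
  by move=> i [_ /N0[/= _ ->]]; rewrite oppr0 mulr0.
rewrite -(fsbig_widen (range h)) //; last first.
  by move=> i [_ /g0 /= ->]; rewrite mul0r.
rewrite (reindex_fsbig_inj _ hI) // (_ : _ @^-1` _ = setT).
  by apply: eq_fsbigr => i _; rewrite gh.
by apply/seteqP; split=> // i _; exists i.
Qed.

Lemma finite_set_bounded_ffun (J : finType) (K : nat) (A : set {ffun J -> nat}) :
  (forall a, A a -> forall v, (a v <= K)%N) -> finite_set A.
Proof.
move=> AK; pose F (b : {ffun J -> 'I_K.+1}) := [ffun v => nat_of_ord (b v)].
apply: (@sub_finite_set _ _ (range F)); last exact/finite_image/finite_finset.
move=> a /AK aK; exists [ffun v => inord (a v)] => //.
by apply/ffunP => v; rewrite !ffunE inordK // ltnS.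
Qed.

Lemma one_sub_pow_coef_N1 k : one_sub_pow_coef (- 1) k = 1.
Proof.
rewrite /= expr1 coef_sum big_ord_recr /= coefXn eqxx big1 ?add0r // => i _.
by rewrite coefXn gtn_eqF.
Qed.

Lemma mul1BX_geom k : (1 - 'X) * (\sum_(j < k.+1) 'X^j) = 1 - 'X^(k.+1) :> {poly int}.
Proof. by rewrite -opprB mulNr -subrX1 opprB. Qed.

(** The truncation order of the geometric series does not affect the lower
    coefficients. *)
Lemma coef_geom_trunc d i j k : (k <= i)%N -> (k <= j)%N ->
  ((\sum_(l < i.+1) 'X^l : {poly int}) ^+ d)`_k =
  ((\sum_(l < j.+1) 'X^l : {poly int}) ^+ d)`_k.
Proof.
elim: d k => [|d IH] k ki kj; first by rewrite !expr0.
rewrite !exprS !coefM; apply: eq_bigr => l _; have lk : (l <= k)%N by rewrite -ltnS.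
congr (_ * _); last by apply: IH; apply: leq_trans (leq_subr _ _) _.
have c h : (k <= h)%N -> (\sum_(l < h.+1) 'X^l : {poly int})`_l = 1.
  move=> kh; rewrite coef_sum (bigD1 (Ordinal (leq_trans (ltn_ord l) (kh : k.+1 <= h.+1)%N))) //=.
  rewrite coefXn eqxx big1 ?addr0 // => p pl; rewrite coefXn.
  by case: eqP => // e; case/eqP: pl; apply/val_inj.
by rewrite !c.
Qed.

(** Multiplication of a power series by 1 - s. *)
Lemma one_sub_pow_coefS m k :
  one_sub_pow_coef (m + 1) k =
  one_sub_pow_coef m k - (if k is k'.+1 then one_sub_pow_coef m k' else 0).
Proof.
have step (p : {poly int}) : ((1 - 'X) * p)`_k = p`_k - (if k is k'.+1 then p`_k' else 0).
  by rewrite mulrBl mul1r coefB coefXM; case: k.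
case: m => [d|d].
  rewrite (_ : Posz d + 1 = Posz d.+1); last by rewrite -addn1 PoszD.
  by rewrite /one_sub_pow_coef exprS step; case: (k).
have -> : one_sub_pow_coef (Negz d + 1) k =
    ((1 - 'X) * (\sum_(j < k.+1) 'X^j) ^+ d.+1 : {poly int})`_k.
  rewrite exprS mulrA mul1BX_geom mulrBl mul1r coefB coefXnM ltnS leqnn subr0.
  case: d => [|d]; first by rewrite !expr0.
  by have -> : Negz d.+1 + 1 = Negz d by lia.
rewrite step; case: k {step} => [|k] //=; congr (_ - _).
by apply: coef_geom_trunc.
Qed.

(** * The intersection form and the dual lattice *)

Lemma cls_eqE n (x y : 'rV[rat]_n) : (cls x = cls y) <-> (x - y \in lattice n).
Proof.
rewrite /cls; split.
- by move/eqP; rewrite Quotient.idealrBE => /eqP ->.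
- by rewrite Quotient.idealrBE => /eqP.
Qed.

Section Forms.
Variables (n : nat) (T : plumbing n).
Local Notation I := (intersection_mx T).

Lemma formE (x y : 'rV[rat]_n) :
  form T x y = \sum_v \sum_w x 0 v * I v w * y 0 w.
Proof.
rewrite /form mxE exchange_big; apply: eq_bigr => w _.
by rewrite [(x *m I) _ _]mxE [y^T _ _]mxE mulr_suml.
Qed.

Lemma form_delta (x : 'rV[rat]_n) v : form T x (delta_mx 0 v) = (x *m I) 0 v.
Proof. by rewrite /form trmx_delta -colE mxE. Qed.

Lemma lattice_denom (x : 'rV[rat]_n) :
  exists2 d : nat, (0 < d)%N & d%:R *: x \in lattice n.
Proof.
exists (\prod_j `|denq (x 0%R j)|)%N.
  by apply: prodn_gt0 => j; rewrite absz_gt0 denq_neq0.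
apply/mxOverP => i j; rewrite (ord1 i) mxE natr_prod (bigD1 j) //=.
rewrite mulrAC natr_absz ger0_norm ?denq_ge0 // -{2}[x 0 j]divq_num_den.
rewrite mulrCA divff ?intr_eq0 ?denq_neq0 // mulr1 rpredM ?intr_int //.
by apply: rpred_prod => k _; apply: natr_int.
Qed.

Hypothesis negT : negative_definite T.

Lemma form_lt0 (x : 'rV[rat]_n) : x != 0 -> form T x x < 0.
Proof.
move=> x0; have [d d0 Ld] := lattice_denom x.
have dr : 0 < d%:R :> rat by rewrite ltr0n.
have := negT Ld; rewrite scaler_eq0 (negPf x0) orbF pnatr_eq0 -lt0n => /(_ d0).
rewrite /form linearZ /= -scalemxAr -!scalemxAl !mxE.
by rewrite pmulr_rlt0 // pmulr_rlt0.
Qed.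

Lemma Estar_mulmx v : Estar T v *m I = - delta_mx 0 v.
Proof.
apply/rowP => w; rewrite -form_delta form_Estar // !mxE eqxx /=.
by rewrite eq_sym.
Qed.

Lemma mulmx_intersection_inj (x y : 'rV[rat]_n) : x *m I = y *m I -> x = y.
Proof.
move=> e; have := congr1 (fun z => z *m invmx I) e.
by rewrite !mulmxK ?negative_definite_unitmx.
Qed.

Lemma sum_Estar_mulmx (c : 'I_n -> rat) w :
  ((\sum_v c v *: Estar T v) *m I) 0 w = - c w.
Proof.
rewrite mulmx_suml summxE (bigD1 w) //= -scalemxAl Estar_mulmx !mxE !eqxx mulrN1.
rewrite big1 ?addr0 // => v vw.
by rewrite -scalemxAl Estar_mulmx !mxE eqxx eq_sym (negPf vw) oppr0 mulr0.
Qed.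

Lemma Estar_expansion (x : 'rV[rat]_n) :
  x = \sum_v (- form T x (delta_mx 0 v)) *: Estar T v.
Proof.
apply: mulmx_intersection_inj; apply/rowP => w.
by rewrite sum_Estar_mulmx form_delta opprK.
Qed.

Lemma dual_Estar v : dual_lattice T (Estar T v).
Proof.
move=> l /mxOverP Ll; rewrite /form Estar_mulmx mulNmx mxE -rowE !mxE rpredN.
exact: Ll.
Qed.

Lemma dual_latticeD x y : dual_lattice T x -> dual_lattice T y ->
  dual_lattice T (x + y).
Proof.
move=> dx dy l Ll; rewrite /form !mulmxDl mxE rpredD //; first exact: dx Ll.
exact: dy Ll.
Qed.

Lemma dual_latticeZ c x : c \is a Num.int -> dual_lattice T x ->
  dual_lattice T (c *: x).
Proof.
by move=> ic dx l Ll; rewrite /form -!scalemxAl mxE rpredM //; apply: dx Ll.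
Qed.

Lemma dual_lattice_sum (J : finType) (c : J -> 'rV[rat]_n) :
  (forall j, dual_lattice T (c j)) -> dual_lattice T (\sum_j c j).
Proof.
move=> dc; elim/big_rec: _ => [l Ll|j y _]; last by apply: dual_latticeD.
by rewrite /form !mul0mx mxE rpred0.
Qed.

Lemma dual_coef_int x v : dual_lattice T x ->
  form T x (delta_mx 0 v) \is a Num.int.
Proof.
by move=> dx; apply: dx; apply/mxOverP => i j; rewrite mxE natr_int.
Qed.

End Forms.

(** * Positivity of the dual basis *)

Section Positivity.
Variables (n : nat) (T : plumbing n).
Local Notation I := (intersection_mx T).
Hypotheses (symT : symmetric (edge T)) (negT : negative_definite T).

(** Pairing x with its negative part y gives (y, y) >= 0, since the
    off-diagonal entries of the form are nonnegative; hence y = 0. *)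
Lemma antinef_ge0 (x : 'rV[rat]_n) :
  (forall w, (x *m I) 0 w <= 0) -> forall w, 0 <= x 0 w.
Proof.
move=> xI; pose y := \row_w Num.max 0 (- x 0 w).
have y0 w : 0 <= y 0 w by rewrite mxE le_max lexx.
suff ye0 : y = 0.
  move=> w; have := congr1 (fun z : 'rV_n => z 0 w) ye0; rewrite !mxE.
  by move=> e; rewrite -oppr_le0 -e le_max lexx orbT.
apply/eqP/negPn/negP => /(form_lt0 negT); apply/negP; rewrite -leNgt.
rewrite (_ : form T y y = form T (x + y) y - form T x y); last first.
  have -> : form T (x + y) y = form T x y + form T y y.
    by rewrite /form !mulmxDl [LHS]mxE.
  by rewrite addrAC subrr add0r.
rewrite subr_ge0; apply: (@le_trans _ _ 0).
  rewrite /form mxE sumr_le0 // => w _.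
  by rewrite [y^T _ _]mxE mulr_le0_ge0 ?xI ?y0.
rewrite formE sumr_ge0 // => v _; rewrite sumr_ge0 // => w _.
have p0 : 0 <= (x + y) 0 v.
  by rewrite !mxE; case: (leP 0 (- x 0 v)) => h; lra.
rewrite [I _ _]mxE; case: (v =P w) => [<-|_]; last first.
  by rewrite !mulr_ge0 //; case: (edge T v w).
suff -> : (x + y) 0 v * (euler T v)%:~R * y 0 v = 0 by [].
by rewrite !mxE; case: (leP 0 (- x 0 v)) => h; ring.
Qed.

Hypothesis connT : forall v w, connect (edge T) v w.

(** A zero of x forces zeros at the neighbouring vertices, hence everywhere by
    connectedness. *)
Lemma antinef_gt0 (x : 'rV[rat]_n) :
  (forall w, (x *m I) 0 w <= 0) -> x != 0 -> forall w, 0 < x 0 w.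
Proof.
move=> xI x0 w; have xge := antinef_ge0 xI.
rewrite lt_def xge andbT; apply/negP => /eqP xw; case/negP: x0.
pose a := [pred v | x 0 v == 0].
have cl : closed (edge T) a.
  apply: intro_closed; first exact: sym_connect_sym.
  move=> v z vz; rewrite !inE => /eqP xv.
  have := xI v; rewrite mxE (bigD1 v) //= xv mul0r add0r => s0.
  have s0' : \sum_(j < n | j != v) x 0 j * I j v == 0.
    rewrite eq_le s0 sumr_ge0 // => j jv.
    rewrite mulr_ge0 // mxE (negPf jv); by case: (edge T j v).
  have [->|zv] := eqVneq z v; first by rewrite xv.
  move: s0'; rewrite psumr_eq0; last first.
    by move=> j jv; rewrite mulr_ge0 // mxE (negPf jv); case: (edge T j v).
  move/allP/(_ z (mem_index_enum _)); rewrite zv mxE (negPf zv) symT vz /=.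
  by rewrite mulr1.
apply/eqP/rowP => v; rewrite mxE.
by apply/eqP; have := closed_connect cl (connT w v); rewrite !inE xw eqxx => <-.
Qed.

Lemma Estar_gt0 v w : 0 < Estar T v 0 w.
Proof.
apply: antinef_gt0 => [z|].
  by rewrite Estar_mulmx // !mxE oppr_le0; case: (_ && _).
apply/eqP => e; have := congr1 (fun z : 'rV_n => z 0 v) (Estar_mulmx negT v).
by rewrite e mul0mx !mxE !eqxx => /eqP; rewrite eq_sym oppr_eq0.
Qed.

End Positivity.

(** * Deleting an end-vertex *)

Section Leaf.
Variables (n : nat) (T : plumbing n.+1) (u : 'I_n.+1).
Local Notation T' := (delete T u).
Local Notation I := (intersection_mx T).
Local Notation I' := (intersection_mx T').
Hypotheses (symT : symmetric (edge T)) (irrT : irreflexive (edge T)).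

Lemma end_vertex_neighbour : end_vertex T u ->
  exists w, forall z, edge T u (lift u z) = (z == w).
Proof.
move=> /mem_card1 [W hW].
have uW : edge T u W by have := hW W; rewrite !inE eqxx.
case: (unliftP u W) => [w eW|eW]; last by rewrite eW irrT in uW.
exists w => z; have := hW (lift u z); rewrite !inE eW => ->.
by rewrite (inj_eq lift_inj).
Qed.

Lemma delete_intersection : I' = \matrix_(v, w) I (lift u v) (lift u w).
Proof. by apply/matrixP => v w; rewrite !mxE (inj_eq lift_inj). Qed.

(** The coordinates other than the one at u. *)
Definition drop_coord (x : 'rV[rat]_n.+1) : 'rV[rat]_n := \row_v x 0 (lift u v).

(** The inclusion of the lattice of T \ u into that of T. *)
Definition extend0 (y : 'rV[rat]_n) : 'rV[rat]_n.+1 :=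
  \row_v (if unlift u v is Some z then y 0 z else 0).

Lemma extend0_lift y v : extend0 y 0 (lift u v) = y 0 v.
Proof. by rewrite mxE liftK. Qed.

Lemma extend0_u y : extend0 y 0 u = 0.
Proof. by rewrite mxE unlift_none. Qed.

Lemma form_extend0 x y : form T (extend0 x) (extend0 y) = form T' x y.
Proof.
rewrite !formE (bigD1_ord u) //= big1 ?add0r; last first.
  by move=> v _; rewrite extend0_u !mul0r.
apply: eq_bigr => v _; rewrite (bigD1_ord u) //= extend0_u mulr0 add0r.
by apply: eq_bigr => w _; rewrite !extend0_lift delete_intersection [in RHS]mxE.
Qed.

Hypothesis negT : negative_definite T.

Lemma negative_definite_delete : negative_definite T'.
Proof.
move=> l Ll l0; rewrite -form_extend0; apply: form_lt0 => //.
apply/eqP => e; case/eqP: l0; apply/rowP => v.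
by have := congr1 (fun z : 'rV_n.+1 => z 0 (lift u v)) e; rewrite extend0_lift !mxE.
Qed.

Lemma euler_lt0 v : euler T v < 0.
Proof.
have : form T (delta_mx 0 v) (delta_mx 0 v) < 0.
  apply: form_lt0 => //; apply/eqP => /rowP/(_ v)/eqP.
  by rewrite !mxE !eqxx oner_eq0.
by rewrite form_delta -rowE !mxE eqxx ltrz0.
Qed.

Variable w : 'I_n.
Hypothesis hw : forall z, edge T u (lift u z) = (z == w).

Lemma drop_coord_proj x :
  drop_coord x = proj T u x + x 0 u *: Estar T' w.
Proof.
have neg' := negative_definite_delete.
apply: (mulmx_intersection_inj neg'); rewrite mulmxDl -scalemxAl Estar_mulmx //.
have -> : proj T u x *m I' = \row_v form T x (delta_mx 0 (lift u v)).
  by apply/rowP => v; rewrite /proj sum_Estar_mulmx // opprK mxE.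
apply/rowP => v.
have -> : (drop_coord x *m I') 0 v =
    \sum_(i < n) x 0 (lift u i) * I (lift u i) (lift u v).
  rewrite mxE; apply: eq_bigr => i _.
  by rewrite delete_intersection [drop_coord _ _ _]mxE [X in _ * X = _]mxE.
rewrite [RHS]mxE [X in X + _]mxE form_delta [(x *m I) _ _]mxE (bigD1_ord u) //=.
rewrite [I _ _]mxE (negPf (neq_lift u v)) hw !mxE eqxx /=.
by case: (v == w) => /=; ring.
Qed.

Lemma Estar_neighbour :
  Estar T (lift u w) = `|euler T u|%:R *: Estar T u - delta_mx 0 u.
Proof.
apply: (mulmx_intersection_inj negT); rewrite mulmxBl -scalemxAl !Estar_mulmx //.
apply/rowP => v; rewrite -rowE !mxE eqxx /=.
have -> : `|euler T u|%:R = - (euler T u)%:~R :> rat.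
  by rewrite natr_absz ltr0_norm ?euler_lt0 // rmorphN.
case: (unliftP u v) => [z ->|->].
- rewrite (negPf (neq_lift u z)) hw eq_sym (inj_eq lift_inj) [lift u z == u]eq_sym.
  by rewrite (negPf (neq_lift u z)) /= eq_sym; case: (_ == _) => /=; ring.
- by rewrite !eqxx (negPf (neq_lift u w)) /=; ring.
Qed.

Lemma valencyE m (S : plumbing m) v : valency S v = (\sum_z edge S v z)%N.
Proof.
by rewrite /valency -sum1_card big_mkcond /=; apply: eq_bigr => z _; rewrite inE; case: edge.
Qed.

Lemma valency_leaf : valency T u = 1%N.
Proof.
rewrite valencyE (bigD1_ord u) //= irrT (bigD1 w) //= hw eqxx big1 // => z zw.
by rewrite hw (negPf zw).
Qed.

Lemma valency_lift v : valency T (lift u v) = (valency T' v + (v == w))%N.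
Proof.
by rewrite !valencyE (bigD1_ord u) //= symT hw addnC.
Qed.

(** A path through u enters and leaves u by w, so that u may be contracted
    to w. *)
Lemma connect_delete_leaf : (forall v z, connect (edge T) v z) ->
  forall v z, connect (edge T') v z.
Proof.
move=> connT v z.
pose a := [pred y | connect (edge T') v (if unlift u y is Some y' then y' else w)].
suff cl : closed (edge T) a.
  have := closed_connect cl (connT (lift u v) (lift u z)).
  by rewrite !inE !liftK connect0.
apply: intro_closed; first exact: sym_connect_sym.
move=> x y xy; rewrite !inE.
case: (unliftP u x) xy => [x' ->|->]; case: (unliftP u y) => [y' ->|->] // xy.
- by move=> vx; apply: connect_trans vx (connect1 _).
- by move: xy; rewrite symT hw => /eqP ->.
- by move: xy; rewrite hw => /eqP ->.
Qed.

End Leaf.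

(** * Counting functions as sums over multi-indices *)

(** The exponent sum_v a_v E*_v attached to a multi-index a. *)
Definition expo n (T : plumbing n) (a : {ffun 'I_n -> nat}) : 'rV[rat]_n :=
  \sum_v Estar T v *+ a v.

(** The coefficient of the multi-index a in the expansion of the zeta series,
    before multi-indices are collected by exponent. *)
Definition zcoef n (T : plumbing n) (a : {ffun 'I_n -> nat}) : int :=
  \prod_v one_sub_pow_coef (dm2 T v) (a v).

Lemma expoE n (T : plumbing n) (a : {ffun 'I_n -> nat}) :
  expo T a = \sum_v (a v)%:R *: Estar T v.
Proof. by apply: eq_bigr => v _; rewrite scaler_nat. Qed.

Lemma expo_coord n (T : plumbing n) (a : {ffun 'I_n -> nat}) z :
  expo T a 0 z = \sum_v (a v)%:R * Estar T v 0 z.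
Proof. by rewrite expoE summxE; apply: eq_bigr => v _; rewrite mxE. Qed.

Lemma not_levP n (x y : 'rV[rat]_n) : ~ lev x y -> exists v, y 0 v < x 0 v.
Proof. by move=> /existsNP[v /negP]; rewrite -ltNge; exists v. Qed.

Section Counting.
Variables (n : nat) (T : plumbing n).
Hypotheses (symT : symmetric (edge T)) (negT : negative_definite T).
Hypothesis (connT : forall v w, connect (edge T) v w).

Lemma dual_expo a : dual_lattice T (expo T a).
Proof.
rewrite expoE; apply: dual_lattice_sum => v.
by apply: dual_latticeZ; [exact: natr_int|exact: dual_Estar].
Qed.

Lemma expo_ge (a : {ffun 'I_n -> nat}) v z : (a v)%:R * Estar T v 0 z <= expo T a 0 z.
Proof.
rewrite expo_coord (bigD1 v) //= lerDl sumr_ge0 // => i _.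
by rewrite mulr_ge0 // ltW // Estar_gt0.
Qed.

Lemma finite_not_above (x : 'rV[rat]_n) :
  finite_set [set a : {ffun 'I_n -> nat} | ~ lev x (expo T a)].
Proof.
pose K v z := Num.bound (`|x 0 z| / Estar T v 0 z).
apply: (@finite_set_bounded_ffun _ (\sum_v \sum_z K v z)%N) => a /= /not_levP[z az] v.
apply: leq_trans (_ : K v z <= _)%N; last first.
  by rewrite (bigD1 v) //= (bigD1 z) //= -addnA leq_addr.
have E0 := Estar_gt0 symT negT connT v z.
rewrite -(ler_nat rat) ltW //; apply: le_lt_trans (archi_boundP _); last first.
  by rewrite divr_ge0 // ltW.
rewrite ler_pdivlMr // (le_trans (expo_ge a v z)) // (le_trans (ltW az)) //.
exact: ler_norm.
Qed.

Lemma counting_sum h x :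
  counting T h x =
  \sum_(a \in [set a | ~ lev x (expo T a) /\ cls (expo T a) = h]) zcoef T a.
Proof.
rewrite /counting /zeta_coef sum_taylor_coef; last first.
  by apply: sub_finite_set (finite_not_above x) => a [].
apply: eq_fsbigl; apply/seteqP; split=> a /=; first by case.
by case=> nl e; split=> //; apply: dual_expo.
Qed.

Lemma expo_pair u (a : {ffun 'I_n -> nat}) :
  \sum_v ((cls (Estar T v), Estar T v 0 u) : disc n * rat) *+ a v =
  (cls (expo T a), expo T a 0 u).
Proof.
rewrite /expo summxE [cls _](raddf_sum (\pi_(disc n)%qT)).
rewrite [LHS]surjective_pairing !raddf_sum /=.
congr (_, _); apply: eq_bigr => v _.
- by rewrite raddfMn [RHS](raddfMn (\pi_(disc n)%qT)).
- by rewrite raddfMn /= -[Estar T v *+ _]scaler_nat [RHS]mxE mulr_natl.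
Qed.

Lemma fH_geom_sum u h w :
  fH_geom_coef T u h w =
  \sum_(a \in [set a | cls (expo T a) = h /\
      exists2 k : nat, (0 < k)%N & expo T a 0 u = w - k%:R]) zcoef T a.
Proof.
rewrite /fH_geom_coef /fH_coef.
pose B := [set y : disc n * rat | exists2 k : nat, (0 < k)%N & y = (h, w - k%:R)].
transitivity (\sum_(y \in B) taylor_coef
  (fun v => (cls (Estar T v), Estar T v 0 u) : disc n * rat) (dm2 T) y).
  rewrite (reindex_fsbig_inj (h := fun k : nat => (h, w - k%:R))).
  - apply: eq_fsbigl; apply/seteqP; split=> k /=; first by exists k.
    by case=> j j0 [] /addrI/oppr_inj/eqP; rewrite eqr_nat => /eqP ->.
  - by move=> i j [] /addrI/oppr_inj/eqP; rewrite eqr_nat => /eqP.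
  - by move=> y [k _ ->]; exists k.
have eB : [set a : {ffun 'I_n -> nat} | B (\sum_v
     ((cls (Estar T v), Estar T v 0 u) : disc n * rat) *+ a v)] =
  [set a | cls (expo T a) = h /\
      exists2 k : nat, (0 < k)%N & expo T a 0 u = w - k%:R].
  apply/seteqP; split=> a; rewrite /B /= expo_pair.
    by case=> k k0 [e1 e2]; split=> //; exists k.
  by case=> e1 [k k0 e2]; exists k; rewrite // e1 e2.
rewrite sum_taylor_coef eB //.
apply: sub_finite_set (finite_not_above (const_mx w)) => a [_ [k k0 e]] /= /(_ u).
rewrite e mxE; have : 0 < k%:R :> rat by rewrite ltr0n.
by lra.
Qed.

End Counting.

(** * The recursion far along E*_u *)

Lemma rowDZ_coord n (p q : 'rV[rat]_n) c v : (p + c *: q) 0 v = p 0 v + c * q 0 v.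
Proof. by rewrite !mxE. Qed.

Lemma rowB_coord n (p q : 'rV[rat]_n) v : (p - q) 0 v = p 0 v - q 0 v.
Proof. by rewrite !mxE. Qed.

Section LeafRecursion.
Variables (n : nat) (T : plumbing n.+1) (u : 'I_n.+1) (w : 'I_n).
Local Notation T' := (delete T u).
Hypotheses (symT : symmetric (edge T)) (irrT : irreflexive (edge T)).
Hypotheses (connT : forall v z, connect (edge T) v z).
Hypotheses (negT : negative_definite T).
Hypothesis hw : forall z, edge T u (lift u z) = (z == w).

Let neg' : negative_definite T' := negative_definite_delete u negT.
Let conn' : forall v z, connect (edge T') v z := connect_delete_leaf symT hw connT.
Let sym' : symmetric (edge T').
Proof. by move=> v z; apply: symT. Qed.

Lemma dm2_leaf : dm2 T u = - 1.
Proof. by rewrite /dm2 (valency_leaf irrT hw). Qed.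

Lemma dm2_lift v : dm2 T (lift u v) = dm2 T' v + (v == w)%:Z.
Proof. by rewrite /dm2 (valency_lift symT hw) PoszD addrAC. Qed.

(** Multi-indices on T are pairs of a multiplicity k at u and a multi-index on
    T \ u; [res_ffun] is the second projection. *)
Definition ext_ffun (k : nat) (a : {ffun 'I_n -> nat}) : {ffun 'I_n.+1 -> nat} :=
  [ffun v => if unlift u v is Some z then a z else k].

Lemma ext_ffun_u k a : ext_ffun k a u = k.
Proof. by rewrite ffunE unlift_none. Qed.

Lemma ext_ffun_lift k a v : ext_ffun k a (lift u v) = a v.
Proof. by rewrite ffunE liftK. Qed.

Definition res_ffun (a : {ffun 'I_n.+1 -> nat}) : {ffun 'I_n -> nat} :=
  [ffun v => a (lift u v)].

Lemma ext_ffunK (a : {ffun 'I_n.+1 -> nat}) : ext_ffun (a u) (res_ffun a) = a.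
Proof.
apply/ffunP => v; case: (unliftP u v) => [z ->|->]; last by rewrite ext_ffun_u.
by rewrite ext_ffun_lift ffunE.
Qed.

Lemma res_ffunK k a : res_ffun (ext_ffun k a) = a.
Proof. by apply/ffunP => v; rewrite ffunE ext_ffun_lift. Qed.

(** The multi-index a + 1_w. *)
Definition bump_ffun (a : {ffun 'I_n -> nat}) : {ffun 'I_n -> nat} :=
  [ffun v => (a v + (v == w))%N].

Lemma bump_ffun_inj : injective bump_ffun.
Proof.
by move=> a b e; apply/ffunP => v; move/ffunP/(_ v): e; rewrite !ffunE => /addIn.
Qed.

(** The coefficient of a in the series of T \ u multiplied by t^(E*_w), that
    is, the coefficient at a - 1_w. *)
Definition shifted_zcoef (a : {ffun 'I_n -> nat}) : int :=
  (if a w is k.+1 then one_sub_pow_coef (dm2 T' w) k else 0) *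
  \prod_(v < n | v != w) one_sub_pow_coef (dm2 T' v) (a v).

Lemma zcoef_ext k a : zcoef T (ext_ffun k a) = zcoef T' a - shifted_zcoef a.
Proof.
rewrite /zcoef (bigD1_ord u) //= ext_ffun_u dm2_leaf one_sub_pow_coef_N1 mul1r.
rewrite (bigD1 w) //= ext_ffun_lift dm2_lift eqxx one_sub_pow_coefS mulrBl.
have -> : \prod_(i < n | i != w) one_sub_pow_coef (dm2 T (lift u i))
    (ext_ffun k a (lift u i)) =
    \prod_(v < n | v != w) one_sub_pow_coef (dm2 T' v) (a v).
  by apply: eq_bigr => v vw; rewrite ext_ffun_lift dm2_lift (negPf vw) addr0.
by rewrite [in RHS](bigD1 w).
Qed.

Lemma shifted_zcoef_bump a : shifted_zcoef (bump_ffun a) = zcoef T' a.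
Proof.
rewrite /shifted_zcoef /zcoef [RHS](bigD1 w) //= ffunE eqxx addn1; congr (_ * _).
by apply: eq_bigr => v vw; rewrite ffunE (negPf vw) addn0.
Qed.

Lemma shifted_zcoef0 a : ~ range bump_ffun a -> shifted_zcoef a = 0.
Proof.
rewrite /shifted_zcoef; case aw: (a w) => [|k]; first by rewrite mul0r.
case; exists [ffun v => (a v - (v == w))%N] => //; apply/ffunP => v.
by rewrite !ffunE subnK //; case: eqP => // ->; rewrite aw.
Qed.

(** The part sum_(v <> u) a_v E*_v of an exponent, the E*_v being those of T. *)
Definition expo_off (a : {ffun 'I_n -> nat}) : 'rV[rat]_n.+1 :=
  \sum_v Estar T (lift u v) *+ a v.

Lemma expo_ext k a : expo T (ext_ffun k a) = Estar T u *+ k + expo_off a.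
Proof.
rewrite /expo (bigD1_ord u) //= ext_ffun_u; congr (_ + _).
by apply: eq_bigr => v _; rewrite ext_ffun_lift.
Qed.

Lemma proj_expo_ext k a : proj T u (expo T (ext_ffun k a)) = expo T' a.
Proof.
rewrite /proj [RHS]expoE; apply: eq_bigr => v _.
by rewrite form_delta expoE sum_Estar_mulmx // ext_ffun_lift opprK.
Qed.

Lemma projD x y : proj T u (x + y) = proj T u x + proj T u y.
Proof.
rewrite /proj -big_split /=; apply: eq_bigr => v _.
by rewrite -scalerDl !form_delta mulmxDl mxE opprD.
Qed.

Lemma projZ c x : proj T u (c *: x) = c *: proj T u x.
Proof.
rewrite /proj scaler_sumr; apply: eq_bigr => v _.
by rewrite !form_delta -scalemxAl mxE scalerA mulrN.
Qed.

Lemma projB x y : proj T u (x - y) = proj T u x - proj T u y.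
Proof. by rewrite projD -scaleN1r projZ scaleN1r. Qed.

Lemma proj_extend0 y : proj T u (extend0 u y) = y.
Proof.
have := drop_coord_proj negT hw (extend0 u y).
rewrite extend0_u scale0r addr0 => <-; apply/rowP => v.
by rewrite mxE extend0_lift.
Qed.

Lemma extend0_lattice y : y \in lattice n -> extend0 u y \in lattice n.+1.
Proof.
move=> /mxOverP Ly; apply/mxOverP => i v; rewrite (ord1 i).
case: (unliftP u v) => [z ->|->]; by rewrite ?extend0_lift ?extend0_u.
Qed.

Lemma expo_ext_bump k a : expo T (ext_ffun k (bump_ffun a)) =
  expo T (ext_ffun (k + `|euler T u|) a) - delta_mx 0 u.
Proof.
have -> : expo T (ext_ffun k (bump_ffun a)) =
    expo T (ext_ffun k a) + Estar T (lift u w).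
  rewrite !expo_ext -addrA; congr (_ + _).
  rewrite /expo_off (bigD1 w) //= [in RHS](bigD1 w) //= ffunE eqxx addn1 mulrSr.
  rewrite [RHS]addrAC; congr (_ + _).
  by apply: eq_bigr => v vw; rewrite ffunE (negPf vw) addn0.
rewrite (Estar_neighbour negT hw) scaler_nat !expo_ext mulrnDr.
by rewrite addrA; congr (_ - _); rewrite addrAC.
Qed.


Lemma lattice_dual m (S : plumbing m) x : x \in lattice m -> dual_lattice S x.
Proof.
move=> /mxOverP Lx l /mxOverP Ll; rewrite formE.
by apply: rpred_sum => v _; apply: rpred_sum => z _; rewrite !rpredM // mxE intr_int.
Qed.

(** The kernel of the projection L' -> L'_(T \ u) is generated by E*_u. *)
Lemma kernel_proj y : dual_lattice T y -> proj T u y = 0 ->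
  exists c : int, y = c%:~R *: Estar T u.
Proof.
move=> dy py; have y0 v : form T y (delta_mx 0 (lift u v)) = 0.
  have := sum_Estar_mulmx neg' (fun v => - form T y (delta_mx 0 (lift u v))) v.
  by rewrite -/(proj T u y) py mul0mx mxE opprK => <-.
have /intrP[c ec] : - form T y (delta_mx 0 u) \is a Num.int.
  by rewrite rpredN dual_coef_int.
exists c; rewrite {1}(Estar_expansion negT y) (bigD1_ord u) //= ec.
by rewrite big1 ?addr0 // => v _; rewrite y0 oppr0 scale0r.
Qed.

(** The point x is far in the direction of E*_u: for the multi-indices a on
    T \ u whose exponent is not above proj x, the u-coordinate of the sum of the
    a_v E*_v, taken in T, is small compared with x_u. *)
Variable x : 'rV[rat]_n.+1.
Hypothesis dx : dual_lattice T x.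
Hypothesis far : forall a, ~ lev (proj T u x) (expo T' a) ->
  expo_off a 0 u + `|euler T u|%:R * Estar T u 0 u <= x 0 u.

(** The multi-indices on T \ u that contribute to the counting function at
    proj x. *)
Definition lower (a : {ffun 'I_n -> nat}) : Prop :=
  ~ lev (proj T u x) (expo T' a) /\ cls (expo T' a) = cls (proj T u x).

(** The multi-indices on T counted at x whose exponent is at least x_u in the
    u-coordinate. *)
Definition gap : set {ffun 'I_n.+1 -> nat} :=
  [set a | [/\ ~ lev x (expo T a), cls (expo T a) = cls x & x 0 u <= expo T a 0 u]].

(** The terms of the counting function with u-coordinate below x_u make up the
    coefficient of f_H(t_u) t_u / (1 - t_u): the difference of two elements of a
    class is an integer in the u-coordinate. *)
Lemma counting_sub_fH_geom :
  counting T (cls x) x =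
  fH_geom_coef T u (cls x) (x 0 u) + \sum_(a \in gap) zcoef T a.
Proof.
rewrite counting_sum // fH_geom_sum //; set A := mkset _; set A2 := mkset _.
have finA : finite_set A.
  by apply: sub_finite_set (finite_not_above symT negT connT x) => a [].
rewrite (fsbigID A2) //; congr (_ + _); apply: eq_fsbigl; apply/seteqP; split=> a /=.
- by case.
- move=> [e [k k0 ek]]; split; split=> //; last by exists k.
  move=> /(_ u); rewrite ek; have : 0 < k%:R :> rat by rewrite ltr0n.
  by lra.
- move=> [[nl e] nA2]; split=> //; rewrite leNgt; apply/negP => lt_u.
  apply: nA2; split=> //; have /cls_eqE/mxOverP/(_ 0 u) := esym e.
  rewrite !mxE => /intrP[c ec].
  have c0 : 0 < c by rewrite -(ltr_int rat) -ec subr_gt0.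
  exists `|c|%N; first by rewrite absz_gt0 gt_eqF.
  by rewrite natr_absz gtr0_norm // -ec; ring.
- move=> [nl e le_u]; split=> // -[_ [k k0 ek]].
  have : 0 < k%:R :> rat by rewrite ltr0n.
  by move: le_u; rewrite ek; lra.
Qed.

(** The multiplicities at u that complete a to an element of the gap set. *)
Definition fibre (a : {ffun 'I_n -> nat}) : set nat := [set k | gap (ext_ffun k a)].

Lemma finite_gap : finite_set gap.
Proof. by apply: sub_finite_set (finite_not_above symT negT connT x) => a []. Qed.

Lemma ext_ffun_inj a : injective (ext_ffun ^~ a).
Proof. by move=> i j /ffunP/(_ u); rewrite !ext_ffun_u. Qed.

Lemma finite_fibre a : finite_set (fibre a).
Proof. by apply: (finite_preimage _ finite_gap) => i j _ _ /ext_ffun_inj. Qed.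

Definition fibre_size (a : {ffun 'I_n -> nat}) : int := \sum_(k \in fibre a) (1 : int).

(** The factor 1 / (1 - t^(E*_u)) has all its coefficients equal to one, so
    that a fibre contributes through its size only. *)
Lemma gap_sum : \sum_(a \in gap) zcoef T a =
  \sum_(a \in setT) (zcoef T' a - shifted_zcoef a) * fibre_size a.
Proof.
rewrite (@fsbig_fiber _ _ _ res_ffun _ setT) //; last exact: finite_gap.
apply: eq_fsbigr => a _; rewrite mulr_fsumr.
rewrite (reindex_fsbig_inj _ (@ext_ffun_inj a)).
  under [LHS]eq_fsbigr do rewrite zcoef_ext.
  under [RHS]eq_fsbigr do rewrite mulr1.
  apply: eq_fsbigl; apply/seteqP; split=> k /=; first by case.
  by move=> g; split=> //=; apply: res_ffunK.
by move=> b [_ /= <-]; exists (b u); rewrite // ext_ffunK.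
Qed.

Lemma finite_fibre_size : finite_set [set a | fibre_size a != 0].
Proof.
apply: sub_finite_set (finite_image res_ffun finite_gap) => a /= Na.
have [k gk] : exists k, fibre a k.
  apply: contra_neqP Na => /forallNP n0; rewrite /fibre_size.
  by rewrite (_ : fibre a = set0) ?fsbig_set0 //; apply/seteqP; split=> // k /n0.
by exists (ext_ffun k a); rewrite ?res_ffunK.
Qed.

Lemma gap_drop a : x 0 u <= expo T a 0 u ->
  lev x (expo T a) <-> lev (drop_coord u x) (drop_coord u (expo T a)).
Proof.
move=> le_u; split=> [le v|le v]; first by rewrite !mxE.
by case: (unliftP u v) => [z ->|-> //]; have := le z; rewrite !mxE.
Qed.

Lemma drop_expo_ext k a : drop_coord u (expo T (ext_ffun k a)) =
  expo T' a + expo T (ext_ffun k a) 0 u *: Estar T' w.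
Proof. by rewrite (drop_coord_proj negT hw) proj_expo_ext. Qed.

Lemma fibre_gap k a : gap (ext_ffun k a) -> ~ lev (proj T u x) (expo T' a).
Proof.
move=> [nl _ le_u] le; apply: nl; apply/gap_drop => // v.
rewrite (drop_coord_proj negT hw) drop_expo_ext !rowDZ_coord lerD //.
by apply: ler_wpM2r => //; apply/ltW/(Estar_gt0 sym' neg' conn').
Qed.

(** The part of the fibre above the level x_u; the condition >= x_u + 1 is the
    same as > x_u, because exponents in the class of x differ from x by integers. *)
Definition fibre_above (a : {ffun 'I_n -> nat}) : set nat :=
  [set k | gap (ext_ffun k a) /\ x 0 u + 1 <= expo T (ext_ffun k a) 0 u].

Lemma expo_ext_u k a :
  expo T (ext_ffun k a) 0 u = k%:R * Estar T u 0 u + expo_off a 0 u.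
Proof. by rewrite expo_ext mxE -scaler_nat mxE. Qed.

(** By [Estar_neighbour], adding 1_w to a amounts to adding b to the
    multiplicity at u and lowering the u-coordinate by one. *)
Lemma fibre_bump a :
  fibre (bump_ffun a) = (addn ^~ `|euler T u|%N) @^-1` fibre_above a.
Proof.
apply/seteqP; split=> k; rewrite /fibre /fibre_above /gap /preimage /= expo_ext_bump;
  set e := expo T _.
all: have eu : (e - delta_mx 0 u) 0 u = e 0 u - 1 by rewrite !mxE !eqxx.
all: have el z : (e - delta_mx 0 u) 0 (lift u z) = e 0 (lift u z)
  by rewrite !mxE eq_sym (negPf (neq_lift u z)) andbF subr0.
all: have -> : cls (e - delta_mx 0 u) = cls e
  by apply/cls_eqE; rewrite addrAC subrr add0r; apply/mxOverP => i j;
     rewrite !mxE rpredN natr_int.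
all: rewrite eu.
- move=> [nl ce le_u]; split; last by lra.
  split=> //; last by lra.
  move=> le; apply: nl => v; case: (unliftP u v) => [z ->|->]; first by rewrite el.
  by rewrite eu.
- move=> [[nl ce _] le_u]; split=> //; last by lra.
  move=> le; apply: nl => v; case: (unliftP u v) => [z ->|->]; last by lra.
  by rewrite -el.
Qed.

Lemma Estar_u_gt0 : 0 < Estar T u 0 u.
Proof. exact: Estar_gt0. Qed.

(** As x_u is large, the multiplicities above the level x_u are at least b. *)
Lemma fibre_above_range a : fibre_above a `<=` range (addn ^~ `|euler T u|%N).
Proof.
move=> k [g le_u]; have := far (fibre_gap g); rewrite expo_ext_u in le_u => le_x.
have d0 := Estar_u_gt0.
suff bk : (`|euler T u| <= k)%N by exists (k - `|euler T u|)%N => //=; rewrite subnK.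
by rewrite -(ler_nat rat) -(ler_pM2r d0); lra.
Qed.

(** The part of the fibre at the level x_u. *)
Definition fibre_level (a : {ffun 'I_n -> nat}) : set nat :=
  [set k | gap (ext_ffun k a) /\ x 0 u = expo T (ext_ffun k a) 0 u].

Lemma fibre_split a : fibre a = fibre_above a `|` fibre_level a.
Proof.
apply/seteqP; split=> k; last by case=> -[].
move=> g; have [_ e le_u] := g.
move/cls_eqE/mxOverP/(_ 0 u): e; rewrite !mxE => /intrP[c ec].
have [c0|c0] := leP c 0.
  right; split=> //; apply/eqP; rewrite eq_le le_u -subr_le0 ec.
  by rewrite lerz0.
left; split=> //; have : 1 <= c%:~R :> rat by rewrite ler1z -gtz0_ge1.
by rewrite -ec; lra.
Qed.

Lemma fibre_level_not_lower a : ~ lower a -> fibre_level a = set0.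
Proof.
move=> nl; apply/seteqP; split=> // k [g eu]; apply: nl; split; first exact: fibre_gap g.
have [_ /cls_eqE/mxOverP Le _] := g; apply/cls_eqE/mxOverP => i v; rewrite (ord1 i).
have e1 : x 0 (lift u v) = proj T u x 0 v + x 0 u * Estar T' w 0 v.
  by rewrite -rowDZ_coord -(drop_coord_proj negT hw) mxE.
have e2 : expo T (ext_ffun k a) 0 (lift u v) =
    expo T' a 0 v + x 0 u * Estar T' w 0 v.
  by rewrite eu -rowDZ_coord -drop_expo_ext mxE.
have := Le 0 (lift u v); rewrite !rowB_coord e1 e2; congr (_ \is a _); ring.
Qed.

(** The multiplicity k is determined by x_u = k d + (expo_off a)_u, d being the
    u-coordinate of E*_u; it is an integer because E*_u spans the kernel of the
    projection, and nonnegative because x_u is large. *)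
Lemma fibre_level_lower a : lower a -> exists k, fibre_level a = [set k].
Proof.
move=> [nl /cls_eqE Ll]; set l := expo T' a - proj T u x in Ll.
have d0 := Estar_u_gt0.
(* y lies in the kernel of the projection, hence is k E*_u for an integer k. *)
pose y := x - expo_off a + extend0 u l.
have off : expo_off a = expo T (ext_ffun 0 a) by rewrite expo_ext add0r.
have py : proj T u y = 0.
  by rewrite projD projB off proj_expo_ext proj_extend0 /l addrA subrK subrr.
have dy : dual_lattice T y.
  apply: dual_latticeD; last exact/lattice_dual/extend0_lattice.
  apply: dual_latticeD => //; rewrite off -scaleN1r.
  by apply: dual_latticeZ => //; apply: dual_expo.
have [c ec] := kernel_proj dy py.
have cu : x 0 u - expo_off a 0 u = c%:~R * Estar T u 0 u.
  have := congr1 (fun z : 'rV_n.+1 => z 0 u) ec.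
  by rewrite [X in X = _]mxE extend0_u addr0 rowB_coord => ->; rewrite [LHS]mxE.
have c0 : 0 <= c.
  rewrite -(ler_int rat) -(ler_pM2r d0) mul0r -cu.
  have := far nl; have : 0 <= `|euler T u|%:R * Estar T u 0 u.
    by rewrite mulr_ge0 // ltW.
  by lra.
case: c c0 ec cu => // k _ ec cu.
have ek : expo T (ext_ffun k a) = x + extend0 u l.
  by rewrite expo_ext -scaler_nat -[k%:R]/(k%:Z%:~R) -ec /y; rewrite addrAC subrK.
have eu : x 0 u = expo T (ext_ffun k a) 0 u.
  by rewrite ek mxE extend0_u addr0.
exists k; apply/seteqP; split=> [j [_ ej]|_ ->].
  move: eu; rewrite ej !expo_ext_u => /addIr/(mulIf (lt0r_neq0 d0))/eqP.
  by rewrite eqr_nat => /eqP.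
split=> //; split; last by rewrite -eu.
- move/gap_drop => /(_ _); rewrite -eu => /(_ (lexx _)) le; apply: nl => v.
  have := le v; rewrite (drop_coord_proj negT hw) drop_expo_ext -eu !rowDZ_coord.
  by rewrite lerD2r.
- by apply/cls_eqE; rewrite ek addrAC subrr add0r extend0_lattice.
Qed.

Lemma fibre_sizeB a :
  fibre_size a - fibre_size (bump_ffun a) = if `[< lower a >] then 1 else 0.
Proof.
have sub0 : fibre_level a `<=` fibre a by rewrite fibre_split => k; right.
have sub1 : fibre_above a `<=` fibre a by rewrite fibre_split => k; left.
have -> : fibre_size (bump_ffun a) = \sum_(k \in fibre_above a) (1 : int).
  rewrite /fibre_size fibre_bump; apply/esym.
  by apply: reindex_fsbig_inj; [exact: addIn|exact: fibre_above_range].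
rewrite /fibre_size fibre_split fsbigU; first last.
- by move=> k [[_ le_u] [_ e]]; move: le_u; rewrite e; lra.
- exact: sub_finite_set sub0 (finite_fibre a).
- exact: sub_finite_set sub1 (finite_fibre a).
rewrite addrC addKr; case: asboolP => [la|/fibre_level_not_lower ->].
  by have [k ->] := fibre_level_lower la; rewrite fsbig_set1.
by rewrite fsbig_set0.
Qed.

Lemma counting_recursion :
  counting T (cls x) x = counting T' (cls (proj T u x)) (proj T u x) +
                         fH_geom_coef T u (cls x) (x 0 u).
Proof.
rewrite counting_sub_fH_geom addrC; congr (_ + _); rewrite gap_sum.
rewrite (@fsbig_abel _ _ bump_ffun (zcoef T') shifted_zcoef fibre_size) //; first last.
- exact: finite_fibre_size.
- exact: shifted_zcoef0.
- exact: shifted_zcoef_bump.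
- exact: bump_ffun_inj.
rewrite counting_sum // [RHS]fsbig_mkcond; apply: eq_fsbigr => a _.
rewrite fibre_sizeB /patch; case: asboolP => la; first by rewrite mem_set // mulr1.
by rewrite memNset // mulr0.
Qed.

End LeafRecursion.

(** * Quasipolynomials along rays *)

Lemma meval_ray m (P : mpoly.mpoly m rat) (x q : 'rV[rat]_m) :
  exists p : {poly rat}, forall t,
    mpoly.meval (fun v => (x + t *: q) 0 v) P = p.[t].
Proof.
elim/mpoly.mpolyind: P => [|c m0 P _ _ [p IH]].
  by exists 0 => t; rewrite mpoly.meval0 horner0.
exists (c *: \prod_v ((x 0 v)%:P + q 0 v *: 'X) ^+ mpoly.fun_of_multinom m0 v + p) => t.
rewrite mpoly.mevalD mpoly.mevalZ mpoly.mevalX IH hornerD hornerZ horner_prod.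
congr (_ * _ + _); apply: eq_bigr => v _.
by rewrite horner_exp hornerD hornerC hornerZ hornerX !mxE [t * _]mulrC.
Qed.

(** By the pigeonhole principle two multiples of q fall in the same coset. *)
Lemma finite_index_multiple m (M Lam : set 'rV[rat]_m) q :
  finite_index_sublattice M Lam -> (forall k : nat, Lam (k%:R *: q)) ->
  exists2 N : nat, (0 < N)%N & forall k, (N %| k)%N -> M (k%:R *: q).
Proof.
move=> [M0 MB _ [s sP]] Lq.
have MN y : M y -> M (- y) by move=> My; rewrite -sub0r; apply: MB.
have /boolp.choice[r rP] k : exists y, y \in s /\ M (k%:R *: q - y).
  by have [y ys My] := sP _ (Lq k); exists y.
have [N N0 MNq] : exists2 N : nat, (0 < N)%N & M (N%:R *: q).
  (* s has size s elements, so two of the first (size s).+1 remainders agree. *)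
  pose F (i : 'I_(size s).+1) : 'I_(size s) :=
    Ordinal (etrans (index_mem (r i) s) (rP i).1).
  have /injectivePn[i [j ij /(congr1 val) /= eij]] : ~~ injectiveb F.
    apply/negP => /injectiveP /leq_card; rewrite !card_ord ltnn.
    by [].
  have er : r i = r j.
    rewrite -(nth_index (r i) (rP i).1) eij (set_nth_default (r j)).
      by rewrite nth_index // (rP j).1.
    by rewrite index_mem (rP j).1.
  have Mij : M ((i%:R - j%:R) *: q).
    have := MB _ _ (rP i).2 (rP j).2.
    by rewrite er opprB addrA subrK scalerBl.
  have [lt|gt|e] := ltngtP i j; last by case/eqP: ij; apply: val_inj.
    exists (j - i)%N; first by rewrite subn_gt0.
    by rewrite natrB 1?ltnW // -opprB scaleNr; apply: MN.
  by exists (i - j)%N; [rewrite subn_gt0|rewrite natrB 1?ltnW].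
exists N => // _ /dvdnP[k ->]; elim: k => [|k IH]; first by rewrite mul0n scale0r.
rewrite mulSn natrD scalerDl -[X in X + _]opprK addrC; apply: MB => //.
exact: MN.
Qed.

Lemma quasipolynomial_ray m (Lam : set 'rV[rat]_m) f x q :
  quasipolynomial Lam f -> Lam x -> (forall k : nat, Lam (k%:R *: q)) ->
  exists2 N : nat, (0 < N)%N & forall N', (N %| N')%N ->
    exists p : {poly rat}, forall t : nat, f (x + (t * N')%:R *: q) = p.[t%:R].
Proof.
move=> [M fiM qP] Lx Lq; have [N N0 NP] := finite_index_multiple fiM Lq.
exists N => // N' NN'; have [P PP] := qP _ Lx.
have [p pP] := meval_ray P x (N'%:R *: q); exists p => t.
rewrite -pP scalerA -natrM; apply: PP; rewrite addrC addKr.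
by apply: NP; apply: dvdn_mull.
Qed.

Lemma poly_eventually0 (p : {poly rat}) (t0 : nat) :
  (forall t : nat, (t0 <= t)%N -> p.[t%:R] = 0) -> p = 0.
Proof.
move=> p0; apply/eqP/negPn/negP => pn0.
pose rs : seq rat := [seq (t0 + i)%:R | i <- iota 0 (size p)].
have := @max_poly_roots _ p rs pn0; rewrite size_map size_iota ltnn.
suff [-> ->] : all (root p) rs /\ uniq rs by move/(_ isT isT).
split; first by apply/allP => _ /mapP[i _ ->]; apply/eqP; rewrite p0 ?leq_addr.
rewrite map_inj_uniq ?iota_uniq // => i j /eqP.
by rewrite eqr_nat eqn_add2l => /eqP.
Qed.

(** Every ray directed by a positive combination of the E*_v ends up in the
    shifted cone. *)
Lemma cone_ray n (T : plumbing n) x (a : {ffun 'I_n -> nat}) :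
  negative_definite T -> dual_lattice T x -> (forall v, (0 < a v)%N) ->
  exists t0 : nat, forall t : nat, (t0 <= t)%N -> exists2 c,
    interior_cone T c &
    x + t%:R *: expo T a = \sum_v (dm2 T v)%:~R *: Estar T v + c.
Proof.
move=> negT dx a0.
pose K v : nat := Num.bound (`|form T x (delta_mx 0 v) + (dm2 T v)%:~R|).
exists (\sum_v K v)%N => t le_t.
have /boolp.choice[c cP] v : exists c : int,
    - form T x (delta_mx 0 v) + (t * a v)%:R - (dm2 T v)%:~R = c%:~R.
  apply/intrP; rewrite rpredB ?intr_int // rpredD ?natr_int // rpredN.
  exact: dual_coef_int.
exists (\sum_v (c v)%:~R *: Estar T v); last first.
  rewrite -big_split /= {1}(Estar_expansion negT x) expoE scaler_sumr -big_split /=.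
  apply: eq_bigr => v _; rewrite -scalerDl scalerA -scalerDl -cP; congr (_ *: _).
  by rewrite natrM; ring.
exists c => // v; rewrite -(ltr0z rat) -cP.
have : (K v)%:R <= t%:R :> rat.
  by rewrite ler_nat (leq_trans _ le_t) // (bigD1 v) //= leq_addr.
have := archi_boundP (normr_ge0 (form T x (delta_mx 0 v) + (dm2 T v)%:~R)).
rewrite -/(K v) => lt1 le1.
have := ler_norm (form T x (delta_mx 0 v) + (dm2 T v)%:~R).
have : t%:R <= (t * a v)%:R :> rat by rewrite ler_nat leq_pmulr.
by lra.
Qed.

Lemma interior_counting n (T : plumbing n) F x (a : {ffun 'I_n -> nat}) :
  is_counting_quasipolynomial T F -> negative_definite T -> dual_lattice T x ->
  (forall v, (0 < a v)%N) ->
  exists t0 : nat, forall t : nat, (t0 <= t)%N ->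
    F (cls x) (x + t%:R *: expo T a) = (counting T (cls x) (x + t%:R *: expo T a))%:~R.
Proof.
move=> FP negT dx a0; have [t0 tP] := cone_ray negT dx a0.
by exists t0 => t /tP[c ic ->]; have [_] := FP _ dx; apply.
Qed.

(** Since the E*'_v have positive coordinates, (expo_off b)_u is at most g
    times any coordinate of the exponent of b on T \ u, for some constant g.
    The coefficient B of E*_u in the direction of the ray is chosen so that the
    u-coordinate grows faster than g times the projection. *)
Lemma ray_far n (T : plumbing n.+1) (u : 'I_n.+1) (w : 'I_n) x :
  symmetric (edge T) -> irreflexive (edge T) ->
  (forall v z, connect (edge T) v z) -> negative_definite T ->
  (forall z, edge T u (lift u z) = (z == w)) ->
  exists2 a : {ffun 'I_n.+1 -> nat}, (forall v, (0 < a v)%N) &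
  1 <= expo T a 0 u /\
  exists t0 : nat, forall t : nat, (t0 <= t)%N -> forall b,
    ~ lev (proj T u (x + t%:R *: expo T a)) (expo (delete T u) b) ->
    expo_off T u b 0 u + `|euler T u|%:R * Estar T u 0 u <=
    (x + t%:R *: expo T a) 0 u.
Proof.
move=> symT irrT connT negT hw; set T' := delete T u.
have neg' : negative_definite T' := negative_definite_delete u negT.
have conn' := connect_delete_leaf symT hw connT.
have sym' : symmetric (edge T') by move=> v z; apply: symT.
have Egt v z : 0 < Estar T v 0 z := Estar_gt0 symT negT connT v z.
have E'gt v z : 0 < Estar T' v 0 z := Estar_gt0 sym' neg' conn' v z.
(* g bounds each ratio (E*_v)_u / (E*'_v)_z. *)
pose g := \sum_v \sum_z Estar T (lift u v) 0 u / Estar T' v 0 z.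
have gt0 v z : 0 <= Estar T (lift u v) 0 u / Estar T' v 0 z.
  by rewrite divr_ge0 // ltW.
have g0 : 0 <= g by apply: sumr_ge0 => v _; apply: sumr_ge0.
have gP v z : Estar T (lift u v) 0 u <= g * Estar T' v 0 z.
  rewrite -ler_pdivrMr // /g (bigD1 v) //= (bigD1 z) //= -addrA lerDl addr_ge0 //.
    exact: sumr_ge0.
  by apply: sumr_ge0 => i _; apply: sumr_ge0.
pose a1 : {ffun 'I_n -> nat} := [ffun => 1%N].
pose s := \sum_z expo T' a1 0 z.
have e0 z : 0 <= expo T' a1 0 z.
  by rewrite expo_coord sumr_ge0 // => v _; rewrite mulr_ge0 // ltW.
have sP z : expo T' a1 0 z <= s.
  by rewrite /s (bigD1 z) //= lerDl sumr_ge0.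
have d0 := Egt u u.
(* B times the u-coordinate of E*_u is at least g s + 1, where s bounds the
   coordinates of the projected direction. *)
pose B := (Num.bound ((g * s + 1) / Estar T u 0 u)).+1.
have BP : g * s + 1 <= B%:R * Estar T u 0 u.
  rewrite -ler_pdivrMr // ltW // (lt_trans (archi_boundP _)) ?ltr_nat //.
  rewrite divr_ge0 //; last exact: ltW.
  by rewrite addr_ge0 // mulr_ge0 // sumr_ge0.
have offE b : expo_off T u b 0 u = \sum_v (b v)%:R * Estar T (lift u v) 0 u.
  by rewrite summxE; apply: eq_bigr => v _; rewrite -scaler_nat mxE.
have off0 b : 0 <= expo_off T u b 0 u.
  by rewrite offE sumr_ge0 // => v _; rewrite mulr_ge0 // ltW.
pose a := ext_ffun u B a1.
have eu : g * s + 1 <= expo T a 0 u.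
  by rewrite expo_ext_u (le_trans BP) // lerDl.
exists a.
  move=> v; case: (unliftP u v) => [z ->|->]; rewrite ?ext_ffun_u //.
  by rewrite ext_ffun_lift ffunE.
split; first by apply: le_trans eu; rewrite lerDr mulr_ge0 // sumr_ge0.
pose px := \sum_z `|proj T u x 0 z|.
exists (Num.bound (g * px + `|euler T u|%:R * Estar T u 0 u + `|x 0 u|)) => t le_t b.
move=> /not_levP[z]; rewrite projD projZ proj_expo_ext // !rowDZ_coord => lz.
have pxz : proj T u x 0 z <= px.
  by rewrite (le_trans (ler_norm _)) // /px (bigD1 z) //= lerDl sumr_ge0.
have offb : expo_off T u b 0 u <= g * expo T' b 0 z.
  rewrite offE expo_coord mulr_sumr; apply: ler_sum => v _.
  by rewrite mulrCA ler_wpM2l.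
have tP : g * px + `|euler T u|%:R * Estar T u 0 u + `|x 0 u| <= t%:R.
  rewrite ltW // (lt_le_trans (archi_boundP _)) ?ler_nat //.
  rewrite !addr_ge0 ?normr_ge0 // mulr_ge0 // ?sumr_ge0 //; exact: ltW.
have h1 : g * expo T' b 0 z <= g * (px + t%:R * s).
  rewrite ler_wpM2l // (le_trans (ltW lz)) // lerD // ler_wpM2l //.
have h2 : t%:R * (g * s + 1) <= t%:R * expo T a 0 u by rewrite ler_wpM2l.
have := ler_normr (- x 0 u); have := ler_norm (- x 0 u); rewrite normrN.
by rewrite !mulrDr in h1 h2 *; lra.
Qed.

Theorem theorem27 (n : nat) (T : plumbing n.+1) (u : 'I_n.+1)
    (LT : disc n.+1 -> 'rV[rat]_n.+1 -> rat)
    (LTu : disc n -> 'rV[rat]_n -> rat)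
    (Lu : disc n.+1 -> rat -> rat) :
  is_tree T -> negative_definite T -> end_vertex T u ->
  is_counting_quasipolynomial T LT ->
  is_counting_quasipolynomial (delete T u) LTu ->
  is_vertex_quasipolynomial T u Lu ->
  forall x : 'rV[rat]_n.+1, dual_lattice T x ->
    LT (cls x) x = LTu (cls (proj T u x)) (proj T u x) + Lu (cls x) (x 0 u).
Proof.
move=> [symT irrT connT _] negT endu HT HTu [Hu1 [Nu Hu2]] x dx.
have [w hw] := end_vertex_neighbour irrT endu.
have neg' : negative_definite (delete T u) := negative_definite_delete u negT.
have [a a0 [eu [t1 far]]] := ray_far x symT irrT connT negT hw.
set q := expo T a in eu far; set q' := expo (delete T u) (res_ffun u a).
have pq : proj T u q = q' by rewrite /q -(ext_ffunK u a) proj_expo_ext // ext_ffunK.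
have dq k : dual_lattice T (k%:R *: q).
  by apply: dual_latticeZ; [exact: natr_int|exact: dual_expo].
have dq' k : dual_lattice (delete T u) (k%:R *: q').
  by apply: dual_latticeZ; [exact: natr_int|exact: dual_expo].
have dpx : dual_lattice (delete T u) (proj T u x).
  apply: dual_lattice_sum => v; apply: dual_latticeZ; last exact: dual_Estar.
  by rewrite rpredN; apply: dual_coef_int.
pose xu : 'rV[rat]_1 := const_mx (x 0 u); pose qu : 'rV[rat]_1 := const_mx (q 0 u).
have [N1 N1_gt0 P1] := quasipolynomial_ray (HT _ dx).1 dx dq.
have [N2 N2_gt0 P2] := quasipolynomial_ray (HTu _ dpx).1 dpx dq'.
have [N3 N3_gt0 P3] : exists2 N : nat, (0 < N)%N & forall N', (N %| N')%N ->
    exists p : {poly rat}, forall t : nat,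
      Lu (cls x) ((xu + (t * N')%:R *: qu) 0 0) = p.[t%:R].
  apply: quasipolynomial_ray (Hu1 _ dx) _ _; first by exists x; rewrite // mxE.
  by move=> k; exists (k%:R *: q); rewrite ?mxE //; apply: dq.
have [N4 N4_gt0 L4] := lattice_denom q.
have [N5 N5_gt0 L5] := lattice_denom q'.
(* N q and N q' are in the lattices, so the classes do not vary on the ray. *)
pose N := (N1 * N2 * N3 * N4 * N5)%N.
have N_gt0 : (0 < N)%N by rewrite !muln_gt0 N1_gt0 N2_gt0 N3_gt0 N4_gt0.
have [D1 D2 D3 D4 D5] : [/\ N1 %| N, N2 %| N, N3 %| N, N4 %| N & N5 %| N]%N.
  split; rewrite /N.
  - by do 4!apply: dvdn_mulr.
  - by do 3!apply: dvdn_mulr; apply: dvdn_mull.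
  - by do 2!apply: dvdn_mulr; apply: dvdn_mull.
  - by apply: dvdn_mulr; apply: dvdn_mull.
  - by apply: dvdn_mull.
have [p1 E1] := P1 _ D1; have [p2 E2] := P2 _ D2; have [p3 E3] := P3 _ D3.
have a0' v : (0 < res_ffun u a v)%N by rewrite ffunE.
have [t2 C2] := interior_counting HT negT dx a0.
have [t3 C3] := interior_counting HTu neg' dpx a0'.
have multL m (y : 'rV[rat]_m) d k : d%:R *: y \in lattice m -> (d %| k)%N ->
    k%:R *: y \in lattice m.
  by move=> Ly /dvdnP[j ->]; rewrite natrM -scalerA scaler_nat rpredMn.
have p0 : p1 - p2 - p3 = 0.
  apply: (@poly_eventually0 _ (t1 + t2 + t3 + Num.bound (`|Nu| + `|x 0 u|))) => t le_t.
  rewrite !hornerD !hornerN -E1 -E2 -E3; set k := (t * N)%N.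
  have le_tk : (t <= k)%N by rewrite leq_pmulr.
  rewrite C2 ?C3; try lia.
  pose y := x + k%:R *: q.
  have py : proj T u y = proj T u x + k%:R *: q' by rewrite projD projZ pq.
  have cy : cls y = cls x.
    by apply/cls_eqE; rewrite /y addrC addKr; exact: multL L4 (dvdn_mull _ D4).
  have cpy : cls (proj T u y) = cls (proj T u x).
    by apply/cls_eqE; rewrite py addrC addKr; exact: multL L5 (dvdn_mull _ D5).
  have dy : dual_lattice T y by apply: dual_latticeD.
  have yu : (xu + k%:R *: qu) 0 0 = y 0 u by rewrite !rowDZ_coord !mxE.
  have big_u : Nu <= y 0 u.
    have : `|Nu| + `|x 0 u| <= k%:R.
      rewrite ltW // (lt_le_trans (archi_boundP _)) ?addr_ge0 // ler_nat.
      by lia.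
    have : k%:R <= k%:R * q 0 u by rewrite ler_peMr.
    have := ler_norm Nu; have := ler_norm (- x 0 u).
    by rewrite normrN rowDZ_coord; lra.
  rewrite yu Hu2 //; last by exists y.
  rewrite -/y -py -cy -cpy (counting_recursion symT irrT connT negT hw) //.
    by rewrite rmorphD /=; ring.
  by apply: far; lia.
have := congr1 (fun p : {poly rat} => p.[0%:R]) p0.
rewrite !hornerD !hornerN horner0 -E1 -E2 -E3 mul0n !scale0r !addr0 mxE => e.
by apply/eqP; rewrite -subr_eq0 opprD addrA e.
Qed.
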